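(* Let $f_1\le f_2\le\cdots$ be an increasing sequence of matrix superharmonic functions $\mathbb{R}^{n\times p}\to\mathbb{R}\cup\{\infty\}$ and assume that $f=\lim_{k\to\infty}f_k\not\equiv\infty$. Then $f$ is also matrix superharmonic.
   Context: The limit is pointwise. Let $S_{0,1}=\{e\in\mathbb{R}^n:\|e\|=1\}$, with surface area element $ds$ and surface area $\Omega_n$ (for $n=1$: counting measure on $\{-1,1\}$, $\Omega_1=2$). For $f:\mathbb{R}^{n\times p}\to\mathbb{R}\cup\{\infty\}$, $X\in\mathbb{R}^{n\times p}$, $\rho\in\mathbb{R}^p$, put $L(f:X,\rho)=\frac{1}{\Omega_n}\int_{S_{0,1}}f(X+e\rho^\top)\,ds(e)$. The function $f$ is matrix superharmonic if (1) $f$ is lower semicontinuous; (2) $f\not\equiv\infty$; (3) $L(f:X,\rho)\le f(X)$ for every $X\in\mathbb{R}^{n\times p}$ and $\rho\in\mathbb{R}^p$. *)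

(* Defs.v *)
From HB Require Import structures.
From mathcomp Require Import all_boot all_order all_algebra.
From mathcomp Require Import all_classical all_reals all_analysis.
From mathcomp Require Import measurable_realfun.

Set Implicit Arguments.
Unset Strict Implicit.
Unset Printing Implicit Defensive.
Import Order.TTheory GRing.Theory Num.Theory.
Import numFieldNormedType.Exports.

Local Open Scope classical_set_scope.
Local Open Scope ring_scope.

(* Points of R^n over which we integrate are n-tuples, because the library
   equips n.-tuple R with the product (that is, Borel) sigma-algebra. *)

Section lebesgue_measure_tuple.
Context {R : realType}.
Local Open Scope ereal_scope.

Definition tcons n (xt : R * n.-tuple R) : n.+1.-tuple R :=
  [the n.+1.-tuple R of xt.1 :: xt.2].

Lemma measurable_tcons n : measurable_fun [set: R * n.-tuple R] (@tcons n).
Proof. exact: measurable_cons. Qed.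

Section step.
Variables (n : nat) (mu : {sigma_finite_measure set (n.-tuple R) -> \bar R}).

Definition lebesgue_step : set (n.+1.-tuple R) -> \bar R :=
  pushforward (@lebesgue_measure R \x mu) (@tcons n).

Let mpre (A : set (n.+1.-tuple R)) :
  measurable A -> measurable (@tcons n @^-1` A).
Proof.
by move=> mA; rewrite -[X in measurable X]setTI; exact: measurable_tcons.
Qed.

Let step0 : lebesgue_step set0 = 0.
Proof. by rewrite /lebesgue_step /pushforward preimage_set0 measure0. Qed.

Let step_ge0 A : 0 <= lebesgue_step A.
Proof. by rewrite /lebesgue_step /pushforward. Qed.

Let step_sigma_additive : semi_sigma_additive lebesgue_step.
Proof.
move=> F mF tF mUF; rewrite /lebesgue_step /pushforward preimage_bigcup.
apply: measure_semi_sigma_additive.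
- by move=> k; exact: mpre.
- apply/trivIsetP => /= i j _ _ ij; rewrite -preimage_setI.
  by move/trivIsetP : tF => /(_ _ _ _ _ ij) ->//; rewrite preimage_set0.
- by rewrite -preimage_bigcup; exact: mpre.
Qed.

HB.instance Definition _ := isMeasure.Build _ _ _ lebesgue_step
  step0 step_ge0 step_sigma_additive.

Let step_sigma_finite : sigma_finite setT lebesgue_step.
Proof.
have [F [FT mF]] : exists F : (set (measurableTypeR R * n.-tuple R))^nat,
    setT = \bigcup_k F k /\
      forall k, measurable (F k) /\ (@lebesgue_measure R \x mu) (F k) < +oo.
  have /sigma_finiteP[G [TG ndG Goo]] := sigma_finiteT (@lebesgue_measure R).
  have /sigma_finiteP[H [TH ndH Hoo]] := sigma_finiteT mu.
  exists (fun k => G k `*` H k); split => //.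
    rewrite -setXTT TG TH predeqE => -[x y]; split.
      move=> [/= [i _ Gx] [j _ Hy]]; exists (maxn i j) => //; split.
      - by move: x Gx; exact/subsetPset/ndG/leq_maxl.
      - by move: y Hy; exact/subsetPset/ndH/leq_maxr.
    by move=> [i _ []/= ? ?]; split; exists i.
  move=> k; have [? ?] := Goo k; have [? ?] := Hoo k.
  split; first exact: measurableX.
  by rewrite product_measure1E// lte_mul_pinfty// ge0_fin_numE.
pose un (t : n.+1.-tuple R) := (thead t, [tuple of behead t] : n.-tuple R).
have unK : cancel (@tcons n) un.
  by case=> x t; congr pair; apply/val_inj.
have mun : measurable_fun setT un.
  by apply: measurable_fun_pair;
    [exact: measurable_tnth | exact: measurable_behead].
have preE A : @tcons n @^-1` (un @^-1` A) = A.
  by apply/seteqP; split => z /=; rewrite unK.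
exists (fun k => un @^-1` F k).
  by rewrite -preimage_bigcup -FT preimage_setT.
move=> k; split.
  by rewrite -[X in measurable X]setTI; apply: mun => //; exact: (mF k).1.
by rewrite /lebesgue_step /pushforward preE; exact: (mF k).2.
Qed.

HB.instance Definition _ := Measure_isSigmaFinite.Build _ _ _ lebesgue_step
  step_sigma_finite.

End step.

(* Lebesgue measure on R^n: the n-fold product of Lebesgue measure on R *)
Fixpoint lebesgue_tuple n : {sigma_finite_measure set (n.-tuple R) -> \bar R} :=
  if n is m.+1 then lebesgue_step (lebesgue_tuple m)
  else @dirac _ (0.-tuple R) [tuple] R.

End lebesgue_measure_tuple.

Section surface_measure.
Context {R : realType} (n : nat).

(* The norm of the library on matrices is the sup norm. *)
Definition enorm (x : n.-tuple R) : R := Num.sqrt (\sum_(i < n) tnth x i ^+ 2).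

Definition unit_sphere : set (n.-tuple R) := [set e | enorm e = 1].

Definition punctured_ball : set (n.-tuple R) := [set x | 0 < enorm x <= 1].

Definition radial (x : n.-tuple R) : n.-tuple R :=
  [tuple tnth x i / enorm x | i < n].

(* The surface measure of A is n times the Lebesgue measure of the part
   { r e : 0 < r <= 1, e in A } of the unit ball that lies over A, as in
   integration in polar coordinates. *)
Definition surface_measure (A : set (n.-tuple R)) : \bar R :=
  (n%:R%:E * lebesgue_tuple n (radial @^-1` A `&` punctured_ball))%E.

Lemma measurable_enorm : measurable_fun setT enorm.
Proof.
apply: (@measurableT_comp _ _ _ _ _ _ (@Num.sqrt R)).
  apply: continuous_measurable_fun; exact: sqrt_continuous.
by apply: measurable_sum => i; apply: measurable_funX; exact: measurable_tnth.
Qed.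

Lemma measurable_radial : measurable_fun setT radial.
Proof.
apply/measurable_fun_tnthP => i.
rewrite (_ : _ \o _ = (fun x => tnth x i * (enorm x `^ (-1)))); last first.
  by apply/funext => x /=; rewrite tnth_mktuple powR_inv1// sqrtr_ge0.
apply: measurable_funM; first exact: measurable_tnth.
apply: (@measurableT_comp _ _ _ _ _ _ (@powR R ^~ (-1))).
  exact: measurable_powR.
exact: measurable_enorm.
Qed.

Lemma measurable_unit_sphere : measurable unit_sphere.
Proof.
rewrite -[X in measurable X]setTI (_ : unit_sphere = enorm @^-1` [set 1])//.
exact: measurable_enorm.
Qed.

Lemma measurable_punctured_ball : measurable punctured_ball.
Proof.
rewrite -[X in measurable X]setTI.
rewrite (_ : punctured_ball = enorm @^-1` `]0, 1]%classic).
  exact: measurable_enorm.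
by apply/seteqP; split => x /=; rewrite in_itv.
Qed.

Let surface0 : surface_measure set0 = 0%E.
Proof. by rewrite /surface_measure preimage_set0 set0I measure0 mule0. Qed.

Let surface_ge0 A : (0 <= surface_measure A)%E.
Proof. by rewrite mule_ge0// lee_fin. Qed.

Let surface_sigma_additive : semi_sigma_additive surface_measure.
Proof.
move=> F mF tF mUF.
have mpre A : measurable A -> measurable (radial @^-1` A).
  by move=> mA; rewrite -[X in measurable X]setTI; exact: measurable_radial.
pose mu := mscale (NngNum (ler0n R n))
  (mrestr (lebesgue_tuple n) measurable_punctured_ball).
rewrite /surface_measure preimage_bigcup.
apply: (@measure_semi_sigma_additive _ _ _ mu (fun k => radial @^-1` F k)).
- by move=> k; exact: mpre.
- apply/trivIsetP => /= i j _ _ ij; rewrite -preimage_setI.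
  by move/trivIsetP : tF => /(_ _ _ _ _ ij) ->//; rewrite preimage_set0.
- by rewrite -preimage_bigcup; exact: mpre.
Qed.

HB.instance Definition _ := isMeasure.Build _ _ _ surface_measure
  surface0 surface_ge0 surface_sigma_additive.

End surface_measure.
Arguments unit_sphere R n : clear implicits.
Arguments surface_measure R n : clear implicits.

Section matrix_superharmonic.
Context {R : realType} (n p : nat).
Local Open Scope ereal_scope.

(* For n > 0 the total mass of the sphere is a positive real number, so that
   the inverse in \bar R is the usual one. *)
Definition sphere_mean (f : 'M[R]_(n, p) -> \bar R) (X : 'M[R]_(n, p))
    (rho : 'cV[R]_p) : \bar R :=
  (surface_measure R n (unit_sphere R n))^-1 *
  \int[surface_measure R n]_(e in unit_sphere R n)
    f (X + (\col_i tnth e i) *m rho^T)%R.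

(* A function with values in R u {oo} is an \bar R-valued function that does
   not take the value -oo. *)
Definition matrix_superharmonic (f : 'M[R]_(n, p) -> \bar R) : Prop :=
  [/\ forall X, f X != -oo,
      lower_semicontinuous f,
      exists X, f X != +oo &
      forall X rho, sphere_mean f X rho <= f X].

End matrix_superharmonic.

(* Main.v *)
(* Each f_k is bounded below by a constant on the sphere X + e rho^T, because f_0
   is lower semicontinuous, never -oo, and the sphere is compact.  Since the
   sphere has finite mass, the positive parts converge in mean by monotone
   convergence and the negative parts by dominated convergence, so the sphere
   means of f_k tend to that of f, and L(f_k : X, rho) <= f_k X <= f X passes to
   the limit. *)
Require Import Defs.
From mathcomp Require Import all_boot all_order all_algebra.
From mathcomp Require Import all_classical all_reals all_analysis.
From mathcomp Require Import measurable_realfun.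

Import Order.TTheory GRing.Theory Num.Theory.
Import numFieldNormedType.Exports.

Local Open Scope classical_set_scope.
Local Open Scope ring_scope.

(** The sets where [g] exceeds [- k] are open, grow with [k] and cover [K]. Compactness, as near
    covering along the filter [\oo] on the naturals, turns the pointwise choice of [k] into a single
    [N]. *)
Lemma compact_lower_semicontinuous_lbound {X : topologicalType} {R : realType}
    (K : set X) (g : X -> \bar R) :
  compact K -> lower_semicontinuous g -> (forall x, K x -> g x != -oo%E) ->
  exists c : R, forall x, K x -> (c%:E <= g x)%E.
Proof.
move=> /compact_near_coveringP cK lg gNy.
have [|N _ KN] := cK nat \oo (fun k x => (- k%:R)%:E < g x)%E _.
  move=> x Kx.
  have [k kx] : exists k : nat, ((- k%:R)%:E < g x)%E.
    have := gNy x Kx; case: (g x) => [r| |] // _; last by exists 0%N; rewrite ltry.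
    exists (Num.bound `|r|); rewrite lte_fin ltrNl.
    by rewrite (le_lt_trans (ler_norm _))// normrN archi_boundP.
  have [V Vx Vg] := lg _ _ kx.
  exists (V, [set m | (k <= m)%N]); first by split=> //=; exists k.
  case=> y m [/= Vy km]; apply: le_lt_trans (Vg _ Vy).
  by rewrite lee_fin lerN2 ler_nat.
by exists (- N%:R) => x Kx; apply/ltW/(KN N) => //=.
Qed.

(* An open set of matrices is a countable union of sup-norm balls with rational
   centres and radii 1 / k.+1. *)
Lemma measurable_preimage_open_mx {d} {T : measurableType d} {R : realType}
    (m n : nat) (g : T -> 'M[R]_(m, n)) (U : set 'M[R]_(m, n)) :
  (forall i j, measurable_fun setT (fun t => g t i j)) -> open U ->
  measurable (g @^-1` U).
Proof.
move=> mg oU.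
pose box (qk : 'M[rat]_(m, n) * nat) :=
  [set Y : 'M[R]_(m, n) | forall i j, `|Y i j - ratr (qk.1 i j)| < qk.2.+1%:R^-1].
(* The union runs over the whole countable index type; a box not contained in [U] contributes
   [set0]. *)
have -> : g @^-1` U = \bigcup_qk (if `[< box qk `<=` U >] then g @^-1` box qk else set0).
  apply/seteqP; split=> [t Ut|t [qk _]]; last by case: asboolP => // + /= ?; apply.
  have [e /= e0 eU] := (nbhs_ballP _ _).1 (open_nbhs_nbhs (conj oU Ut)).
  (* With a radius below [e / 2], [g t] and any other point of the box are both that close to the
     centre [q], hence within [e] of each other. *)
  have [k _ /(_ k (leqnn k)) /= ke] :=
    near_infty_natSinv_lt (PosNum (divr_gt0 e0 (ltr0n R 2))).
  have qP i j : exists q : rat, `|g t i j - ratr q| < k.+1%:R^-1.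
    have /rat_in_itvoo[q] : g t i j - k.+1%:R^-1 < g t i j + k.+1%:R^-1.
      by rewrite ltrD2l gtrN// invr_gt0.
    by rewrite in_itv/= -ltr_distlC => ?; exists q.
  have [q qE] := choice (fun ij : 'I_m * 'I_n => qP ij.1 ij.2).
  exists (\matrix_(i, j) q (i, j), k) => //; rewrite asboolT.
    by move=> i j /=; rewrite mxE; exact: (qE (i, j)).
  move=> Y Yq; apply: eU; split=> // i j.
  have := Yq i j; rewrite /= mxE distrC => Yqij; rewrite /ball/= [e]splitr.
  rewrite (le_lt_trans (ler_distD (ratr (q (i, j))) _ _))// ltrD//.
    exact: lt_trans (qE (i, j)) ke.
  exact: lt_trans Yqij ke.
apply: countable_bigcupT_measurable => // -[q k].
case: ifP => // _.
rewrite (_ : _ @^-1` _ = \bigcap_(ij in [set: 'I_m * 'I_n])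
    (fun t => `|g t ij.1 ij.2 - ratr (q ij.1 ij.2)|) @^-1` `]-oo, k.+1%:R^-1[); last first.
  apply/seteqP; split=> [t tq [i j] _ /=|t tq i j]; first by rewrite in_itv/= tq.
  by have := tq (i, j) I; rewrite /= in_itv.
apply: fin_bigcap_measurable => [|[i j] _ /=]; first exact: finite_finset.
rewrite -[X in measurable X]setTI; apply: measurableT_comp => //.
exact: measurable_funB.
Qed.

(** The rays above a real [a] generate the sigma-algebra of the extended reals, and [f] pulls each
    of them back to an open set of matrices. *)
Lemma lower_semicontinuous_measurable_mx {d} {T : measurableType d} {R : realType}
    (m n : nat) (g : T -> 'M[R]_(m, n)) (f : 'M[R]_(m, n) -> \bar R) :
  (forall i j, measurable_fun setT (fun t => g t i j)) ->
  lower_semicontinuous f -> measurable_fun setT (f \o g).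
Proof.
move=> mg /lower_semicontinuousP lf.
apply: (measurability _ (ErealGenOInfty.measurableE R)).
move=> /= _ [_ [a ->]] <-; apply: measurableI => //.
rewrite preimage_itvoy.
exact: measurable_preimage_open_mx (lf a).
Qed.

(** Since [mu D] is finite, the constant [|c|] is integrable and dominates every negative part,
    while the positive parts increase. Each part thus has its own limit theorem, whatever the sign
    of [c]. *)
Lemma cvg_integral_nondecreasing_lbound d (T : measurableType d) (R : realType)
    (mu : {measure set T -> \bar R}) (D : set T) (g_ : nat -> T -> \bar R)
    (g : T -> \bar R) (c : R) :
  measurable D -> (mu D < +oo)%E -> (forall k, measurable_fun D (g_ k)) ->
  (forall x, D x -> (c%:E <= g_ 0%N x)%E) ->
  (forall x, D x -> nondecreasing_seq (g_ ^~ x)) ->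
  (forall x, D x -> g_ k x @[k --> \oo] --> g x) ->
  (\int[mu]_(x in D) g_ k x)%E @[k --> \oo] --> (\int[mu]_(x in D) g x)%E.
Proof.
move=> mD muD mg cg ndg gg.
(* Both parts have the form [maxe u 0], with [u] the function or its opposite, so this serves for
   both. *)
have cvg_max0 (u : nat -> \bar R) l : u k @[k --> \oo] --> l ->
    maxe (u k) 0%E @[k --> \oo] --> maxe l 0%E.
  move=> ul; apply: (@continuous2_cvg _ _ _ _ \oo _ u (cst 0%E) maxe) ul (cvg_cst _).
  exact: (@max_continuous _ (\bar R) (l, 0%E)).
have cg_ k x : D x -> (c%:E <= g_ k x)%E.
  by move=> Dx; rewrite (le_trans (cg x Dx))// ndg.
have cgl x : D x -> (c%:E <= g x)%E.
  by move=> Dx; apply: cvge_ge (gg x Dx); near=> k; exact: cg_.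
have neg_le (h : T -> \bar R) x : (c%:E <= h x)%E -> (`|h^\- x| <= `|c|%:E)%E.
  move=> ch; rewrite gee0_abs// funenegE ge_max lee_fin normr_ge0 andbT.
  rewrite leeNl (le_trans _ ch)// -EFinN lee_fin lerNl.
  by rewrite -normrN ler_norm.
have ic : mu.-integrable D (cst `|c|%:E).
  apply/integrableP; split; first exact: measurable_cst.
  by rewrite integral_cst// lte_mul_pinfty// ?gee0_abs// ?lee_fin.
have mgl : measurable_fun D g by apply: emeasurable_fun_cvg mg gg.
have -> : (fun k => \int[mu]_(x in D) g_ k x)%E = (fun k =>
    \int[mu]_(x in D) (g_ k)^\+ x - \int[mu]_(x in D) (g_ k)^\- x)%E.
  by apply/funext => k; rewrite integralE.
rewrite integralE; apply: cvgeB.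
(* The difference of the limits is not of the form oo - oo: [g] is also at least [c], so [g^\-] has
   a finite integral. *)
- apply: fin_num_adde_defl; rewrite fin_numN.
  apply: integrable_fin_num => //.
  apply: le_integrable ic => //; first exact: measurable_funeneg.
  by move=> x Dx; rewrite (le_trans (neg_le _ _ (cgl _ Dx)))//= normr_id.
- have <- : (\int[mu]_(x in D) limn (fun k => (g_ k)^\+ x))%E = (\int[mu]_(x in D) g^\+ x)%E.
    by apply: eq_integral => x /[1!inE] Dx; apply/cvg_lim => //; rewrite funeposE;
      under eq_cvg do rewrite funeposE; exact: cvg_max0 (gg x Dx).
  apply: cvg_monotone_convergence => //.
  + by move=> k; exact: measurable_funepos.
  + by move=> x Dx k l kl; rewrite !funeposE le_max2// ndg.
- apply: (dominated_cvg mD _ _ _ ic) => //=.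
  + by move=> k; exact: measurable_funeneg.
  + move=> x Dx; under eq_cvg do rewrite funenegE; rewrite funenegE.
    apply: cvg_max0; apply: cvgeN; exact: gg.
  + by move=> k x Dx; exact: neg_le (cg_ k x Dx).
Unshelve. all: by end_near. Qed.

(** Induction on the dimension: under [tcons] the cube is the segment [-1, 1] times the cube one
    dimension lower. Measurability is carried along because the product formula for rectangles asks
    for it. *)
Lemma lebesgue_tuple_box_lty {R : realType} n :
  let B : set (n.-tuple R) := [set x | forall i, `|tnth x i| <= 1] in
  measurable B /\ (lebesgue_tuple n B < +oo)%E.
Proof.
elim: n => [|n [mB IH]] B; split.
- rewrite (_ : B = setT)//; by apply/seteqP; split=> // x _ [].
- by rewrite [lebesgue_tuple 0]/lebesgue_tuple /= diracE ltry.
- rewrite (_ : B = \bigcap_(i in setT) (fun x => `|tnth x i|) @^-1` `]-oo, 1]); last first.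
    apply/seteqP; split=> [x Bx i _ /=|x Bx i]; first by rewrite in_itv/= Bx.
    by have := Bx i I; rewrite /= in_itv.
  apply: fin_bigcap_measurable => [|i _]; first exact: finite_finset.
  rewrite -[X in measurable X]setTI; apply: measurableT_comp => //.
  exact: measurable_tnth.
- rewrite /= /lebesgue_step /pushforward.
  rewrite (_ : _ @^-1` _ = `[-1, 1]%classic `*` [set x | forall i, `|tnth x i| <= 1]).
    rewrite product_measure1E// lte_mul_pinfty// ge0_fin_numE//.
    exact: compact_finite_measure (@segment_compact R (-1) 1).
  apply/seteqP; split=> [[x t] /= H|[x t] [/= + H] i].
    split=> [|i]; first by have := H ord0; rewrite (tnth_nth 0)/= ler_norml.
    by have := H (lift ord0 i); rewrite !(tnth_nth 0).
  rewrite in_itv/= -ler_norml.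
  by case: (unliftP ord0 i) => [j ->|->]; rewrite (tnth_nth 0)//= -tnth_nth.
Qed.

Lemma ler_norm_enorm {R : realType} n (x : n.-tuple R) i :
  `|tnth x i| <= enorm x.
Proof.
rewrite -sqrtr_sqr ler_wsqrtr// (bigD1 i)//= lerDl sumr_ge0// => j _.
exact: sqr_ge0.
Qed.

(** The part of the punctured ball over the sphere lies in the cube of side 2, whose Lebesgue
    measure is finite. *)
Lemma surface_measure_unit_sphere_lty {R : realType} n :
  (surface_measure R n (unit_sphere R n) < +oo)%E.
Proof.
rewrite /surface_measure lte_mul_pinfty// ?lee_fin//.
have [mB] := @lebesgue_tuple_box_lty R n.
apply: le_lt_trans; apply: le_measure; rewrite ?inE//.
  apply: measurableI; last exact: measurable_punctured_ball.
  rewrite -[X in measurable X]setTI; apply: measurable_radial => //.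
  exact: measurable_unit_sphere.
move=> x [_ /andP[_ x1]] i; apply: (@le_trans _ R (enorm x)) => //; exact: ler_norm_enorm.
Qed.

(** The coordinates form a bare function [v] to cover both tuples, used for integration, and row
    vectors, used for compactness. *)
Lemma ray_mxE {R : realType} n p (X : 'M[R]_(n, p)) (v : 'I_n -> R)
    (rho : 'cV[R]_p) i j :
  (X + (\col_i v i) *m rho^T) i j = X i j + v i * rho j 0.
Proof. by rewrite !mxE big_ord1 !mxE. Qed.

(** The bound is found on the whole cube of row vectors with entries in [-1, 1]: it is compact,
    contains the sphere, and is mapped continuously by [M] into the matrices. *)
Lemma lower_semicontinuous_unit_sphere_lbound {R : realType} n p
    (g : 'M[R]_(n, p) -> \bar R) (X : 'M[R]_(n, p)) (rho : 'cV[R]_p) :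
  lower_semicontinuous g -> (forall Y, g Y != -oo%E) ->
  exists c : R, forall e, unit_sphere R n e ->
    (c%:E <= g (X + (\col_i tnth e i) *m rho^T)%R)%E.
Proof.
move=> lg gNy.
pose M (v : 'rV[R]_n) := X + (\col_i v 0 i) *m rho^T.
have cM : continuous M.
  move=> v U /nbhs_ballP[e /= e0 eU].
  (* Balls of matrices are entrywise and there are finitely many entries, so continuity of each
     entry suffices. *)
  have : \forall w \near v, forall ij : 'I_n * 'I_p,
      ball (M v ij.1 ij.2) e (M w ij.1 ij.2).
    apply: (@filter_forall _ _ _ _ (nbhs_filter v)) => -[i j].
    have : X i j + w 0 i * rho j 0 @[w --> v] --> X i j + v 0 i * rho j 0.
      apply: (@cvgD _ _ _ _ (nbhs_filter v) (fun=> _)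
        (fun w : 'rV[R]_n => w 0 i * rho j 0)).
        exact: (@cvg_cst _ _ _ _ (nbhs_filter v)).
      apply: (@cvgM _ _ _ (nbhs_filter v) _ (fun=> _)).
        exact: coord_continuous.
      exact: (@cvg_cst _ _ _ _ (nbhs_filter v)).
    move=> /(_ _ (nbhsx_ballx _ _ e0)); apply: (@filterS _ _ (nbhs_filter v)) => w.
    by rewrite /M !ray_mxE.
  by apply: (@filterS _ _ (nbhs_filter v)) => w Mw; apply: eU; split => // i j; exact: (Mw (i, j)).
have lgM : lower_semicontinuous (g \o M).
  move/lower_semicontinuousP : lg => og; apply/lower_semicontinuousP => a.
  by apply: (open_comp _ (og a)) => v _; exact: cM.
have cK := @rV_compact R n (fun=> `[-1, 1]%classic) (fun=> @segment_compact R _ _).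
have [c cg] := compact_lower_semicontinuous_lbound _ _ cK lgM (fun v _ => gNy (M v)).
exists c => e e1.
have <- : M (\row_i tnth e i) = X + (\col_i tnth e i) *m rho^T.
  by congr (_ + _ *m _); apply/matrixP => i j; rewrite !mxE.
by apply: cg => i; rewrite /= mxE in_itv/= -ler_norml -[leRHS]e1 ler_norm_enorm.
Qed.

Theorem lemma3p6 (R : realType) (n p : nat) (n_gt0 : (0 < n)%N) (p_gt0 : (0 < p)%N)
    (fs : nat -> 'M[R]_(n, p) -> \bar R) (f : 'M[R]_(n, p) -> \bar R)
    (fs_superharmonic : forall k, matrix_superharmonic (fs k))
    (fs_increasing : forall k X, (fs k X <= fs k.+1 X)%E)
    (fs_cvg : forall X, fs k X @[k --> \oo] --> f X)
    (f_proper : exists X, f X != +oo%E) :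
  matrix_superharmonic f.
Proof.
have fs_ndecr X : nondecreasing_seq (fs ^~ X).
  by apply/nondecreasing_seqP => k; exact: fs_increasing.
have fs_le k X : (fs k X <= f X)%E.
  apply: cvge_ge (fs_cvg X); exists k => // m /= km; exact: fs_ndecr.
have fNy X : f X != -oo%E.
  have [fs0Ny _ _ _] := fs_superharmonic 0%N.
  by rewrite -ltNye (lt_le_trans _ (fs_le 0%N X))// ltNye fs0Ny.
split => // [X a aX|X rho].
  (* If every [fs k X] were at most [a], so would be the limit [f X]. A neighbourhood on which
     [fs k] exceeds [a] then serves for [f], which lies above [fs k]. *)
  have [k ak] : exists k, (a%:E < fs k X)%E.
    apply/not_existsP => fsa; move: aX; rewrite ltNge => /negP; apply.
    apply: cvge_le (fs_cvg X); apply: nearW => k.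
    by rewrite leNgt; apply/negP; exact: fsa.
  have [_ /(_ X a ak)[V VX Va] _ _] := fs_superharmonic k.
  by exists V => // Y /Va aY; exact: lt_le_trans aY (fs_le k Y).
set S := unit_sphere R n; set mu := surface_measure R n.
pose ray (g : 'M[R]_(n, p) -> \bar R) e := g (X + (\col_i tnth e i) *m rho^T).
have mS : measurable S := @measurable_unit_sphere R n.
have mfs k : measurable_fun S (ray (fs k)).
  have [_ lfs _ _] := fs_superharmonic k.
  apply: measurable_funTS.
  apply: (lower_semicontinuous_measurable_mx _ _ _ _ _ lfs) => i j.
  under eq_fun do rewrite ray_mxE.
  apply: measurable_funD => //; apply: measurable_funM => //.
  exact: measurable_tnth.
have mf : measurable_fun S (ray f).
  by apply: emeasurable_fun_cvg mfs _ => e _; exact: fs_cvg.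
have mean_cvg : sphere_mean (fs k) X rho @[k --> \oo] --> sphere_mean f X rho.
  (* The factor [(mu S)^-1] can be pulled out of the limit when it is finite, which follows from
     [mu S] being nonzero. Over a null sphere all the integrals vanish, and the means are constantly
     0. *)
  have [mu0|mu_neq0] := eqVneq (mu S) 0%E.
    have null g : measurable_fun S (ray g) -> sphere_mean g X rho = 0%E.
      by move=> mg; rewrite /sphere_mean null_set_integral ?mule0.
    have -> : (fun k => sphere_mean (fs k) X rho) = cst 0%E.
      by apply/funext => k; exact: null.
    by rewrite null//; exact: cvg_cst.
  apply: cvgeZl; first by rewrite fin_numV// gt_eqF// (lt_le_trans (ltNyr 0)).
  have [fs0Ny lfs0 _ _] := fs_superharmonic 0%N.
  have [c cfs0] := lower_semicontinuous_unit_sphere_lbound _ _ _ X rho lfs0 fs0Ny.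
  apply: (cvg_integral_nondecreasing_lbound _ _ _ mu S (fun k => ray (fs k))
    (ray f) c) => //.
  - exact: surface_measure_unit_sphere_lty.
  - by move=> e _; exact: fs_ndecr.
  - by move=> e _; exact: fs_cvg.
apply: cvge_le mean_cvg; apply: nearW => k.
have [_ _ _ /(_ X rho) mean_le] := fs_superharmonic k.
exact: le_trans mean_le (fs_le k X).
Qed.
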